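(* Let $\mu>0$ and $k\geq\frac16$. The energy $$W_{\exp,k}(F)=\frac{\mu}{k}\sum_{i=1}^3e^{k\log^2\lambda_i},\qquad F\in\mathrm{SL}(3),$$ where $\lambda_i=\nu_i(F)$, is the restriction to $\mathrm{SL}(3)$ of the polyconvex function given by $$P(X,Y,d)=\sum_{i=1}^3\bar g_k\left(\nu_i(X+Y)\right),\qquad (X,Y,d)\in\mathbb{R}^{3\times3}\times\mathbb{R}^{3\times3}\times(0,\infty),$$ where $$\bar g_k(s)=\begin{cases}\dfrac{\mu}{k}+\mu(s-2),&0\leq s\leq2,\\[1em]\dfrac{\mu}{k}\exp\left(k\,\operatorname{arcosh}^2\left(\dfrac{s}{2}\right)\right),&s\geq2;\end{cases}$$ that is, $P$ is convex and $W_{\exp,k}(F)=P(F,\operatorname{Cof}F,\det F)$ for all $F\in\mathrm{SL}(3)$. Consequently, $W_{\exp,k}$ is rank-one convex on $\mathrm{SL}(3)$.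
   Context: For $X\in\mathbb{R}^{3\times3}$, $\nu_1(X),\nu_2(X),\nu_3(X)\ge0$ denote its singular values, counted with multiplicity. For invertible $F$, $\operatorname{Cof}F=(\det F)F^{-T}$. $\mathrm{SL}(3)$ is the set of real $3\times3$ matrices with determinant $1$. $\operatorname{arcosh}\colon[1,\infty)\to[0,\infty)$ is the inverse of $\cosh$ on $[0,\infty)$; $\log^2\lambda=(\log\lambda)^2$ and $\operatorname{arcosh}^2(x)=(\operatorname{arcosh}x)^2$. A function $F\mapsto W(F)$ on the set of real $3\times3$ matrices with positive determinant is polyconvex if there is a convex $P\colon\mathbb{R}^{3\times3}\times\mathbb{R}^{3\times3}\times(0,\infty)\to\mathbb{R}$ with $W(F)=P(F,\operatorname{Cof}F,\det F)$ for all such $F$. A function $W\colon\mathrm{SL}(3)\to\mathbb{R}$ is rank-one convex on $\mathrm{SL}(3)$ if, for all $F\in\mathrm{SL}(3)$ and $a,b\in\mathbb{R}^3$ such that $F_t=F+t\,a\otimes b\in\mathrm{SL}(3)$ for all $t\in[0,1]$, the function $t\mapsto W(F_t)$ is convex on $[0,1]$. Here $a\otimes b=ab^T$. *)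

(* Defs.v *)
From HB Require Import structures.
From mathcomp Require Import all_boot all_order all_algebra.
From mathcomp Require Import ring lra complex.
From mathcomp Require Import all_classical all_reals all_analysis.

Set Implicit Arguments.
Unset Strict Implicit.
Unset Printing Implicit Defensive.

Import Order.TTheory GRing.Theory Num.Theory.

Local Open Scope classical_set_scope.
Local Open Scope ring_scope.

(* The s_i >= 0, in nonincreasing order, whose squares are the eigenvalues of
   X^T X, counted with multiplicity. *)
Definition is_singular_values (R : realType) (n : nat) (X : 'M[R]_n)
    (s : n.-tuple R) : Prop :=
  [/\ sorted >=%R s, (forall i, 0 <= tnth s i)
    & char_poly (X^T *m X) = \prod_(i < n) ('X - (tnth s i ^+ 2)%:P)].

(* The default value is never used, see [singular_valuesP]. *)
Definition singular_values (R : realType) (n : nat) (X : 'M[R]_n) : n.-tuple R :=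
  xget [tuple of nseq n 0] [set s | is_singular_values X s].

Definition nu (R : realType) (n : nat) (X : 'M[R]_n) (i : 'I_n) : R :=
  tnth (singular_values X) i.

Section SingularValuesExist.
Variables (R : realType) (n : nat).
Local Notation C := (complex R).
Local Notation toC := (real_complex R).

Lemma char_poly_conj (K : fieldType) (P A : 'M[K]_n) : P \in unitmx ->
  char_poly (invmx P *m A *m P) = char_poly A.
Proof.
move=> Pu; rewrite /char_poly /char_poly_mx !map_mxM.
have E : map_mx polyC (invmx P) *m map_mx polyC P = 1%:M.
  by rewrite -map_mxM mulVmx // map_scalar_mx.
have -> : 'X%:M - map_mx polyC (invmx P) *m map_mx polyC A *m map_mx polyC P
  = map_mx polyC (invmx P) *m ('X%:M - map_mx polyC A) *m map_mx polyC P.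
  rewrite mulmxBr mulmxBl; congr (_ - _).
  by rewrite scalar_mxC -mulmxA E mulmx1.
by rewrite !det_mulmx mulrAC -det_mulmx E det1 mul1r.
Qed.

Lemma singular_values_exist (X : 'M[R]_n) : exists s, is_singular_values X s.
Proof.
pose Y := map_mx toC X.
have YT : Y^T = map_mx Num.conj Y^T.
  apply/matrixP => i j; rewrite !mxE.
  by apply/esym/CrealP; rewrite complex_real.
have YC : map_mx Num.conj Y = Y.
  by apply/matrixP => i j; have /matrixP/(_ j i) := YT; rewrite !mxE.
pose A := Y^T *m Y.
have Aherm : A \is hermsymmx.
  apply/is_hermitianmxP; rewrite expr0 scale1r /A trmx_mul trmxK map_mxM.
  by rewrite -YT YC.
have /orthomx_spectralP AE := hermitian_normalmx Aherm.
set P := spectralmx A in AE; set D := spectral_diag A in AE.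
have Pu : P \in unitmx := spectral_unit A.
have cA : char_poly A = \prod_(i < n) ('X - (D 0 i)%:P).
  rewrite AE char_poly_conj // char_poly_trig ?diag_mx_is_trig//.
  by apply: eq_bigr => i _; rewrite !mxE eqxx mulr1n.
have D0 i : 0 <= D 0 i.
  pose Z := Y *m map_mx Num.conj P^T.
  have DE : diag_mx D = map_mx Num.conj Z^T *m Z.
    have PV : invmx P = map_mx Num.conj P^T.
      by rewrite invmx_unitary ?spectral_unitarymx // map_trmx.
    have -> : diag_mx D = P *m A *m invmx P.
      by rewrite AE !mulmxA mulmxV // mul1mx -mulmxA mulmxV // mulmx1.
    rewrite PV /A /Z trmx_mul map_mxM -YT !mulmxA.
    congr (_ *m _ *m _ *m _).
    apply/matrixP => a b.
    by rewrite !mxE; apply/esym; exact: conjCK.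
  have := congr1 (fun M : 'M[C]_n => M i i) DE.
  rewrite [LHS]mxE eqxx mulr1n => ->; rewrite mxE; apply: sumr_ge0 => j _.
  by rewrite !mxE mulrC mul_conjC_ge0.
pose r i : R := complex.Re (D 0 i).
have rE i : D 0 i = toC (r i).
  by rewrite /r /= RRe_real // ger0_real.
have r0 i : 0 <= r i by rewrite -ler0c -rE.
have cR : char_poly (X^T *m X) = \prod_(i < n) ('X - (r i)%:P).
  apply: (map_poly_inj toC); rewrite map_char_poly rmorph_prod /=.
  rewrite map_mxM -map_trmx -/Y -/A cA; apply: eq_bigr => i _.
  by rewrite rmorphB /= map_polyX map_polyC rE.
pose t := [tuple of mktuple (fun i => Num.sqrt (r i))].
exists [tuple of sort >=%R t]; split.
- exact/sort_sorted/ge_total.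
- move=> i.
  have : tnth [tuple of sort >=%R t] i \in sort >=%R t by exact: mem_tnth.
  by rewrite mem_sort => /tnthP [j ->]; rewrite tnth_mktuple sqrtr_ge0.
rewrite cR.
transitivity (\prod_(x <- t) ('X - (x ^+ 2)%:P)).
  rewrite big_tuple; apply: eq_bigr => i _.
  by rewrite tnth_mktuple sqr_sqrtr.
rewrite -(perm_big _ (permEl (perm_sort >=%R t))) /=.
by rewrite -(big_tuple _ _ [tuple of sort >=%R t] xpredT
  (fun x => 'X - (x ^+ 2)%:P)).
Qed.

Lemma singular_valuesP (X : 'M[R]_n) : is_singular_values X (singular_values X).
Proof. exact: xgetPex (singular_values_exist X). Qed.

End SingularValuesExist.

Definition Cof (R : realType) (n : nat) (F : 'M[R]_n) : 'M[R]_n :=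
  \det F *: (invmx F)^T.

Definition SL3 (R : realType) : set 'M[R]_3 := [set F | \det F = 1].

Definition cosh (R : realType) (x : R) : R := (expR x + expR (- x)) / 2.

Definition arcosh (R : realType) : R -> R :=
  'pinv_(fun=> 0) `[0, +oo[%classic (@cosh R).

Lemma coshK (R : realType) : {in `[0, +oo[%classic, cancel (@cosh R) (@arcosh R)}.
Proof.
apply: pinvKV => x y; rewrite !inE /= !in_itv /= !andbT => x0 y0.
rewrite /cosh !expRN => E; apply: expR_inj; move: E.
have := expR_gt0 x; have := expR_gt0 y.
have : 1 <= expR x by rewrite -expR0 ler_expR.
have : 1 <= expR y by rewrite -expR0 ler_expR.
move: (expR x) (expR y) => u v v1 u1 v0 u0 E.
have vN0 := lt0r_neq0 v0; have uN0 := lt0r_neq0 u0.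
have : (u - v) * (u * v - 1) = 0.
  have -> : (u - v) * (u * v - 1) =
    2 * u * v * ((u + u^-1) / 2 - (v + v^-1) / 2) by field; exact/andP.
  by rewrite E subrr mulr0.
move/eqP; rewrite mulf_eq0 => /orP[/eqP|/eqP]; first by move/subr0_eq.
by nra.
Qed.

Definition poly_dom (R : realType) : set ('M[R]_3 * 'M[R]_3 * R^o) :=
  [set p | 0 < p.2].

Definition polyconvex (R : realType) (W : 'M[R]_3 -> R) : Prop :=
  exists P : 'M[R]_3 * 'M[R]_3 * R^o -> R,
    convex_function (@poly_dom R) P /\
    forall F : 'M[R]_3, 0 < \det F -> W F = P (F, Cof F, \det F).

(* W is total, but only its values on SL(3) are used. *)
Definition rank_one_convex_SL3 (R : realType) (W : 'M[R]_3 -> R) : Prop :=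
  forall (F : 'M[R]_3) (a b : 'cV[R]_3), SL3 F ->
    (forall t : R, 0 <= t <= 1 -> SL3 (F + t *: (a *m b^T))) ->
    convex_function (E := R^o) `[0, 1]%classic
      (fun t : R => W (F + t *: (a *m b^T))).

Definition W_exp (R : realType) (mu k : R) (F : 'M[R]_3) : R :=
  mu / k * \sum_(i < 3) expR (k * ln (nu F i) ^+ 2).

Definition gbar (R : realType) (mu k s : R) : R :=
  if s <= 2 then mu / k + mu * (s - 2)
  else mu / k * expR (k * arcosh (s / 2) ^+ 2).

(* The two branches agree at s = 2, where arcosh 1 = 0. *)
Lemma gbar_ge2 (R : realType) (mu k s : R) : 2 <= s ->
  gbar mu k s = mu / k * expR (k * arcosh (s / 2) ^+ 2).
Proof.
rewrite le_eqVlt => /orP[/eqP <-|]; last by rewrite /gbar ltNge => /negbTE ->.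
have cosh0 : cosh 0 = 1 :> R by rewrite /cosh oppr0 expR0 divff.
rewrite /gbar lexx subrr mulr0 addr0 divff // -cosh0 coshK.
  by rewrite expr0n mulr0 expR0 mulr1.
by rewrite inE /= in_itv /= lexx.
Qed.

Definition P_exp (R : realType) (mu k : R) (p : 'M[R]_3 * 'M[R]_3 * R^o) : R :=
  \sum_(i < 3) gbar mu k (nu (p.1.1 + p.1.2) i).

(* Main.v *)
Require Import Defs.
From mathcomp Require Import all_boot all_order all_algebra.
From mathcomp Require Import ring lra complex.
From mathcomp Require Import all_classical all_reals all_analysis.

(* Convexity of [P_exp]: if [M = U diag(s) V] is a singular value decomposition,
   then [s_i] is the diagonal entry [d_i M] of [U^* M V^*], which is linear in
   [M], while for any other matrix [A] the entries [Re (d_i A)] are dominated by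
   the image of the singular values of [A] under a doubly substochastic matrix.
   By Jensen, [sum_i g (d_i A) <= sum_i g (nu_i A)] for every convex
   nondecreasing [g], and convexity of [sum_i g (nu_i)] follows from that of [g].

   Convexity of [gbar]: in the variable [x] with [s = 2 cosh x] its slope is
   [mu x e^(k x^2) / sinh x], whose monotonicity for [k >= 1/6] reduces to
   [x cosh x <= (1 + x^2 / 3) sinh x].

   On SL(3) the singular values of [F + Cof F] are [s_i + 1 / s_i], that is
   [2 cosh (ln s_i)], and [F + Cof F] is affine along rank-one segments. *)

Set Implicit Arguments.
Unset Strict Implicit.
Unset Printing Implicit Defensive.

Import Order.TTheory GRing.Theory Num.Theory.

Local Open Scope classical_set_scope.
Local Open Scope ring_scope.

(** * Partial isometries and the singular value decomposition *)

Section PartialIsometries.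
Variables (C : numClosedFieldType) (n : nat).
Implicit Types A W X : 'M[C]_n.
Local Notation "A ^*t" := (map_mx Num.conj A^T) (at level 2).

Lemma adjmxK A : A^*t^*t = A.
Proof. by apply/matrixP => i j; rewrite !mxE conjCK. Qed.

Lemma adjmxM A W : (A *m W)^*t = W^*t *m A^*t.
Proof. by rewrite trmx_mul map_mxM. Qed.

Lemma mulmx_adj_diag A i : (A *m A^*t) i i = \sum_j `|A i j| ^+ 2.
Proof. by rewrite mxE; apply: eq_bigr => j _; rewrite !mxE normCK. Qed.

(** Working with [W W^* W = W] instead of unitarity avoids completing the left singular vectors to a
    basis when the matrix is singular. *)
Definition partial_isometry W : Prop := W *m W^*t *m W = W.

Lemma adj_partial_isometry W : partial_isometry W -> partial_isometry W^*t.
Proof.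
by move=> WP; rewrite /partial_isometry adjmxK -[in RHS]WP !adjmxM adjmxK mulmxA.
Qed.

Lemma unitarymx_partial_isometry W : W \is unitarymx -> partial_isometry W.
Proof. by move=> /unitarymxP WP; rewrite /partial_isometry WP mul1mx. Qed.

(** [E = W W^*] is an orthogonal projection, and the difference of the two sides is the squared norm
    of row [i] of [A (1 - E)]. *)
Lemma partial_isometry_row_le A W i : partial_isometry W ->
  \sum_j `|(A *m W) i j| ^+ 2 <= \sum_j `|A i j| ^+ 2.
Proof.
move=> WP; rewrite -!mulmx_adj_diag -subr_ge0.
have [E [EE EH WE]] : exists E, [/\ E *m E = E, E^*t = E & W *m W^*t = E].
  by exists (W *m W^*t); rewrite mulmxA WP adjmxM adjmxK.
have -> : (A *m A^*t) i i - (A *m W *m (A *m W)^*t) i i =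
    ((A - A *m E) *m (A - A *m E)^*t) i i.
  have -> : (A - A *m E)^*t = A^*t - E *m A^*t.
    by rewrite linearB /= map_mxB adjmxM EH.
  rewrite mulmxBl !mulmxBr !mulmxA -[A *m E *m E]mulmxA EE subrr subr0.
  by rewrite adjmxM !mulmxA -[A *m W *m _]mulmxA WE [RHS]mxE [X in _ = _ + X]mxE.
by rewrite mulmx_adj_diag sumr_ge0 // => j _; rewrite exprn_ge0.
Qed.

Lemma partial_isometry_row W X i : partial_isometry W -> partial_isometry X ->
  \sum_j `|(W *m X) i j| ^+ 2 <= 1.
Proof.
move=> WP XP; apply: le_trans (partial_isometry_row_le _ _ XP) _.
rewrite -[W]mul1mx; apply: le_trans (partial_isometry_row_le _ _ WP) _.
rewrite (bigD1 i) //= mxE eqxx normr1 expr1n big1 ?addr0 // => j ji.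
by rewrite mxE eq_sym (negbTE ji) normr0 expr0n.
Qed.

Lemma partial_isometry_col W X j : partial_isometry W -> partial_isometry X ->
  \sum_i `|(W *m X) i j| ^+ 2 <= 1.
Proof.
move=> /adj_partial_isometry WP /adj_partial_isometry XP.
apply: le_trans (partial_isometry_row j XP WP).
by rewrite -adjmxM; apply: ler_sum => i _; rewrite !mxE norm_conjC.
Qed.

(** The last conclusion makes [U^* A P^*] equal to [diag s] even when [A] is singular. *)
Lemma svd A (P : 'M[C]_n) (s : 'rV[C]_n) : P \is unitarymx ->
    (forall i, 0 <= s 0 i) ->
    A^*t *m A = invmx P *m diag_mx (\row_i s 0 i ^+ 2) *m P ->
  exists U : 'M[C]_n, [/\ partial_isometry U, A = U *m diag_mx s *m P
    & U^*t *m U *m diag_mx s = diag_mx s].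
Proof.
move=> Pu s0 AE.
have PV := invmx_unitary Pu.
have PP : P *m P^*t = 1%:M by apply/unitarymxP.
have PP' : P^*t *m P = 1%:M by rewrite -PV mulVmx // unitarymx_unit.
have [B BE] : exists B, B = A *m P^*t by exists (A *m P^*t).
have BB : B^*t *m B = diag_mx (\row_i s 0 i ^+ 2).
  rewrite BE adjmxM adjmxK !mulmxA -[P *m _ *m A]mulmxA AE PV !mulmxA PP mul1mx.
  by rewrite -mulmxA PP mulmx1.
(* As [0^-1 = 0], [diag t] is the pseudo-inverse of [diag s]. *)
pose t := \row_i (s 0 i)^-1.
have tH : (diag_mx t)^*t = diag_mx t.
  apply/matrixP => i j; rewrite !mxE [j == i]eq_sym.
  have [->|_] := eqVneq i j; last by rewrite !mulr0n rmorph0.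
  by rewrite !mulr1n; apply/CrealP; rewrite ger0_real // invr_ge0.
have BS : B *m diag_mx t *m diag_mx s = B.
  apply/matrixP => i j.
  rewrite -mulmxA mulmx_diag mul_mx_diag !mxE.
  have [sj|sj] := eqVneq (s 0 j) 0; last by rewrite mulVf // mulr1.
  (* A zero [s_j] kills column [j] of [B], whose squared norm is this diagonal entry. *)
  have: (B^*t *m B) j j = 0 by rewrite BB !mxE eqxx sj expr0n mulr1n.
  rewrite -{2}[B]adjmxK mulmx_adj_diag => /eqP; rewrite psumr_eq0; last first.
    by move=> k _; rewrite exprn_ge0.
  move=> /allP /(_ i); rewrite mem_index_enum => /(_ isT); rewrite !mxE.
  by rewrite expf_eq0 /= normr_eq0 fmorph_eq0 => /eqP b0; rewrite b0 mul0r.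
have UU : (B *m diag_mx t)^*t *m (B *m diag_mx t) =
    diag_mx (\row_i ((s 0 i)^-1 * s 0 i)).
  rewrite adjmxM tH mulmxA -[_ *m B]mulmxA BB !mulmx_diag; congr diag_mx.
  apply/rowP => i; rewrite !mxE.
  have [->|sj] := eqVneq (s 0 i) 0; first by rewrite invr0 !mul0r.
  by rewrite expr2 mulKf // mulrC.
exists (B *m diag_mx t); split.
- rewrite /partial_isometry -mulmxA UU -mulmxA mulmx_diag; congr (_ *m diag_mx _).
  apply/rowP => i; rewrite !mxE.
  have [->|sj] := eqVneq (s 0 i) 0; first by rewrite invr0 !mulr0.
  by rewrite mulVf // mulr1.
- by rewrite BS BE -mulmxA PP' mulmx1.
- rewrite UU mulmx_diag; congr diag_mx; apply/rowP => i; rewrite !mxE.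
  have [->|sj] := eqVneq (s 0 i) 0; first by rewrite invr0 !mul0r.
  by rewrite mulVf // mul1r.
Qed.

End PartialIsometries.

(** * Sums of a function over the singular values of a real matrix *)

Section SingularValueSums.
Variables (R : realType) (n : nat).
Implicit Types X A M : 'M[R]_n.
Local Notation C := (complex R).
Local Notation toC := (real_complex R).
Local Notation "A ^*t" := (map_mx Num.conj A^T) (at level 2).

(** The characteristic polynomial determines the multiset of the [s i ^+ 2], and nonnegativity that
    of the [s i], so [s] may come in any order. *)
Lemma sum_nu X (f : R -> R) (s : 'I_n -> R) : (forall i, 0 <= s i) ->
    char_poly (X^T *m X) = \prod_i ('X - (s i ^+ 2)%:P) ->
  \sum_i f (nu X i) = \sum_i f (s i).
Proof.
move=> s0 Xs; have [_ t0 Xt] := singular_valuesP X.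
pose sq (u : 'I_n -> R) := [seq u i ^+ 2 | i <- index_enum 'I_n].
have fE u : (forall i, 0 <= u i) ->
    \sum_i f (u i) = \sum_(x <- sq u) f (Num.sqrt x).
  by move=> u0; rewrite big_map; apply: eq_bigr => i _; rewrite sqrtr_sqr ger0_norm.
rewrite !fE //; apply/perm_big/prod_XsubC_eq.
by rewrite !big_map -Xs.
Qed.

Lemma adjmx_real X : (map_mx toC X)^*t = map_mx toC X^T.
Proof.
by apply/matrixP => i j; rewrite !mxE; apply/CrealP; rewrite complex_real.
Qed.

Lemma gram_spectral X : exists (P : 'M[C]_n) (s : 'I_n -> R),
  [/\ P \is unitarymx, (forall i, 0 <= s i),
      map_mx toC (X^T *m X) =
        invmx P *m diag_mx (\row_i toC (s i) ^+ 2) *m P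
    & char_poly (X^T *m X) = \prod_i ('X - (s i ^+ 2)%:P)].
Proof.
have [_ t0 Xt] := singular_valuesP X.
set A := map_mx toC (X^T *m X).
have Aherm : A \is hermsymmx.
  apply/is_hermitianmxP; rewrite expr0 scale1r adjmx_real.
  by rewrite trmx_mul trmxK.
have /orthomx_spectralP AE := hermitian_normalmx Aherm.
set P := spectralmx A in AE; set D := spectral_diag A in AE.
have Pu : P \in unitmx := spectral_unit A.
have cA : char_poly A = \prod_i ('X - (D 0 i)%:P).
  rewrite AE char_poly_conj // char_poly_trig ?diag_mx_is_trig //.
  by apply: eq_bigr => i _; rewrite !mxE eqxx mulr1n.
(* An eigenvalue of [A] is a root of the complexified product that defines the singular values,
   hence the square of one of them. *)
have DE i : exists j, D 0 i = toC (nu X j ^+ 2).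
  have: root (char_poly A) (D 0 i).
    by rewrite cA /root horner_prod (bigD1 i) //= hornerXsubC subrr mul0r.
  rewrite -map_char_poly Xt rmorph_prod /root horner_prod prodf_seq_eq0.
  move=> /hasP [j _] /=; rewrite rmorphB /= map_polyX map_polyC hornerXsubC.
  by rewrite subr_eq0 => /eqP ->; exists j.
have sE i : D 0 i = toC (Num.sqrt (complex.Re (D 0 i)) ^+ 2).
  by have [j ->] := DE i; rewrite /= sqrtr_sqr ger0_norm ?t0.
exists P, (fun i => Num.sqrt (complex.Re (D 0 i))); split.
- exact: spectral_unitarymx.
- by move=> i; rewrite sqrtr_ge0.
- rewrite [LHS]AE; congr (_ *m diag_mx _ *m _); apply/rowP => i.
  by rewrite mxE [LHS]sE rmorphXn.
apply: (map_poly_inj toC); rewrite map_char_poly rmorph_prod /= -/A cA.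
apply: eq_bigr => i _; rewrite rmorphB /= map_polyX map_polyC [in LHS]sE //.
Qed.

Lemma real_svd X : exists (U P : 'M[C]_n) (s : 'I_n -> R),
  let S := diag_mx (\row_i toC (s i)) in
  [/\ partial_isometry U /\ P \is unitarymx, (forall i, 0 <= s i),
      map_mx toC X = U *m S *m P, U^*t *m U *m S = S
    & char_poly (X^T *m X) = \prod_i ('X - (s i ^+ 2)%:P)].
Proof.
have [P [s [Pu s0 XE cX]]] := gram_spectral X.
have [||U [Up UE US]] := @svd _ _ (map_mx toC X) P (\row_i toC (s i)) Pu.
- by move=> i; rewrite mxE ler0c.
- rewrite adjmx_real -map_mxM XE; congr (_ *m diag_mx _ *m _).
  by apply/rowP => i; rewrite !mxE.
by exists U, P, s; split.
Qed.

Lemma Re_real_mul (a : R) (z : C) : complex.Re (toC a * z) = a * complex.Re z.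
Proof. by case: z => x y /=; rewrite mul0r subr0. Qed.

(* [d] reads off the diagonal of a matrix in the singular bases of [M]. *)
Lemma nu_diagonal M : exists d : 'M[R]_n -> 'I_n -> R,
  [/\ forall (a b : R) A B i, d (a *: A + b *: B) i = a * d A i + b * d B i,
      forall f : R -> R, \sum_i f (nu M i) = \sum_i f (d M i)
    & forall A, exists (S : 'M[R]_n) (s : 'I_n -> R),
      [/\ forall i j, 0 <= S i j, forall i, \sum_j S i j <= 1,
          forall j, \sum_i S i j <= 1, forall i, d A i <= \sum_j S i j * s j
        & (forall i, 0 <= s i) /\
          forall f : R -> R, \sum_i f (nu A i) = \sum_i f (s i)]].
Proof.
have [U [P [s [[Up Pu] s0 ME US cM]]]] := real_svd M.
have PP : P *m P^*t = 1%:M by apply/unitarymxP.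
have Pp := unitarymx_partial_isometry Pu.
exists (fun A i => complex.Re ((U^*t *m map_mx toC A *m P^*t) i i)); split.
- move=> a b A B i; rewrite map_mxD !map_mxZ mulmxDr mulmxDl.
  by rewrite -!scalemxAr -!scalemxAl !mxE raddfD /= !Re_real_mul.
- move=> f; rewrite (sum_nu f s0 cM); apply: eq_bigr => i _.
  by rewrite ME !mulmxA US -mulmxA PP mulmx1 !mxE eqxx mulr1n.
move=> A; have [U1 [P1 [t [[U1p P1u] t0 AE _ cA]]]] := real_svd A.
have P1p := unitarymx_partial_isometry P1u.
have [Y YE] : exists Y, U^*t *m U1 = Y by exists (U^*t *m U1).
have [Z ZE] : exists Z, P1 *m P^*t = Z by exists (P1 *m P^*t).
pose q (z : C) := complex.Re (`|z| ^+ 2).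
have qE z : toC (q z) = `|z| ^+ 2 by rewrite RRe_real // rpredX ?normr_real.
have q0 z : 0 <= q z by rewrite -ler0c qE exprn_ge0.
have qsum (F : 'I_n -> C) : \sum_j `|F j| ^+ 2 <= 1 -> \sum_j q (F j) <= 1.
  by rewrite -lecR rmorph_sum; under eq_bigr do rewrite -qE.
have half_sum (F G : 'I_n -> C) :
    \sum_j `|F j| ^+ 2 <= 1 -> \sum_j `|G j| ^+ 2 <= 1 ->
    \sum_j (q (F j) + q (G j)) / 2 <= 1.
  move=> /qsum F1 /qsum G1; rewrite -mulr_suml big_split /=; lra.
(* The [i]-th diagonal entry of [U^* A P^*] is [sum_j Y_ij t_j Z_ji], and [|Y_ij Z_ji|] is at most
   the mean of the two squared moduli. Rows and columns of [Y] and [Z] have norm at most 1, so these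
   means form a doubly substochastic matrix. *)
exists (\matrix_(i, j) ((q (Y i j) + q (Z j i)) / 2)), t; split.
- by move=> i j; rewrite mxE divr_ge0 // addr_ge0.
- move=> i; under eq_bigr do rewrite mxE; apply: half_sum.
    by rewrite -YE; exact: partial_isometry_row (adj_partial_isometry Up) U1p.
  by rewrite -ZE; exact: partial_isometry_col P1p (adj_partial_isometry Pp).
- move=> j; under eq_bigr do rewrite mxE; apply: half_sum.
    by rewrite -YE; exact: partial_isometry_col (adj_partial_isometry Up) U1p.
  by rewrite -ZE; exact: partial_isometry_row P1p (adj_partial_isometry Pp).
- move=> i; rewrite AE !mulmxA YE -mulmxA ZE mxE raddf_sum /=; apply: ler_sum => j _.
  rewrite mul_mx_diag !mxE -mulrA [toC _ * _]mulrC mulrA.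
  rewrite mulrC Re_real_mul mulrC ler_wpM2r //.
  rewrite -lecR; apply: le_trans (_ : `|Y i j * Z j i| <= _).
    by apply: le_trans (normc_ge_Re _); rewrite lecR ler_norm.
  rewrite rmorphM rmorphD /= !qE normrM fmorphV rmorph_nat -subr_ge0.
  rewrite [leRHS](_ : _ = (`|Y i j| - `|Z j i|) ^+ 2 / 2); last by field.
  by rewrite divr_ge0 // real_exprn_even_ge0 // rpredB ?normr_real.
- split=> // f; exact: sum_nu.
Qed.

(** Convexity and monotonicity of [g] enter together as a supporting line of nonnegative slope at
    every point. *)
Lemma sum_nu_convex (g : R -> R) (l : R) A B : 0 <= l <= 1 ->
    (forall x, exists2 m, 0 <= m & forall y, g x + m * (y - x) <= g y) ->
  \sum_i g (nu (l *: A + (1 - l) *: B) i) <=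
    l * \sum_i g (nu A i) + (1 - l) * \sum_i g (nu B i).
Proof.
move=> /andP[l0 l1] supp; set M := l *: A + (1 - l) *: B.
have [d [dlin dM dle]] := nu_diagonal M.
have dS X : \sum_i g (d X i) <= \sum_i g (nu X i).
  have [S [s [S0 Sr Sc dX [s0 ->]]]] := dle X.
  have gs j : 0 <= g (s j) - g 0.
    rewrite subr_ge0; have [m m0 /(_ (s j))] := supp 0; apply: le_trans.
    by rewrite lerDl subr0 mulr_ge0.
  (* Jensen's inequality for row [i] of [S], with the missing mass [1 - sum_j S i j] placed at the
     point 0. *)
  have gd i : g (d X i) <= g 0 + \sum_j S i j * (g (s j) - g 0).
    have [m m0 gm] := supp (d X i); set x := d X i in gm *.
    have le1 : \sum_j S i j * (g x + m * (s j - x) - g 0) <=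
        \sum_j S i j * (g (s j) - g 0).
      by apply: ler_sum => j _; rewrite ler_wpM2l // lerD2r.
    rewrite -lerBlDl; apply: le_trans le1.
    have -> : \sum_j S i j * (g x + m * (s j - x) - g 0) =
        (\sum_j S i j) * (g x - m * x - g 0) + m * \sum_j S i j * s j.
      rewrite mulr_suml mulr_sumr -big_split /=.
      by apply: eq_bigr => j _; ring.
    have := ler_wpM2l m0 (dX i); have := gm 0; have := Sr i.
    rewrite -/x; move: (\sum_j S i j) (\sum_j _) => a b a1 g0 mb; nra.
  apply: le_trans (ler_sum _ (fun i _ => gd i)) _.
  (* After exchanging the sums, each [g (s j) - g 0 >= 0] has a column sum of [S] as its weight, at
     most 1. *)
  rewrite big_split exchange_big -big_split /=; apply: ler_sum => j _.
  by rewrite -mulr_suml -lerBrDl ler_piMl.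
rewrite dM !mulr_sumr -big_split /=.
apply: le_trans (_ : l * \sum_i g (d A i) + (1 - l) * \sum_i g (d B i) <= _).
  rewrite !mulr_sumr -big_split /=; apply: ler_sum => i _; rewrite dlin.
  have [m m0 gm] := supp (l * d A i + (1 - l) * d B i).
  have l1' : 0 <= 1 - l by rewrite subr_ge0.
  apply: le_trans (lerD (ler_wpM2l l0 (gm (d A i))) (ler_wpM2l l1' (gm (d B i)))).
  by rewrite le_eqVlt; apply/orP; left; apply/eqP; ring.
rewrite big_split /= -!mulr_sumr.
by apply: lerD; rewrite ler_wpM2l ?subr_ge0 // dS.
Qed.

(** With [N = A^T A] and [Cof A = A^-T], the Gram matrix of [A + Cof A] is [N + 2 + N^-1]. It is
    diagonal in the eigenbasis of [N], with eigenvalues [s_i^2 + 2 + s_i^-2 = (s_i + 1 / s_i)^2]. *)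
Lemma sum_nu_add_Cof A (f : R -> R) : \det A = 1 ->
  exists s : 'I_n -> R, [/\ forall i, 0 < s i,
    forall h : R -> R, \sum_i h (nu A i) = \sum_i h (s i)
    & \sum_i f (nu (A + Cof A) i) = \sum_i f (s i + (s i)^-1)].
Proof.
move=> dA; have [P [s [Pu s0 AE cA]]] := gram_spectral A.
have Aunit : A \in unitmx by rewrite unitmxE dA unitr1.
have Punit := unitarymx_unit Pu.
have sN0 i : s i != 0.
  have: \det (map_mx toC (A^T *m A)) = 1.
    by rewrite det_map_mx det_mulmx det_tr dA mulr1 rmorph1.
  rewrite AE !det_mulmx mulrAC -det_mulmx mulVmx // det1 mul1r det_diag.
  rewrite (bigD1 i) //= mxE => /eqP; apply: contraTneq => ->.
  by rewrite rmorph0 expr0n mul0r eq_sym oner_eq0.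
have s_gt0 i : 0 < s i by rewrite lt_neqAle eq_sym sN0 s0.
exists s; split=> //; first by move=> h; exact: sum_nu.
apply: (@sum_nu _ f (fun i => s i + (s i)^-1)).
  by move=> i; rewrite addr_ge0 // invr_ge0.
set D := diag_mx _ in AE.
pose D' := diag_mx (\row_i (toC (s i) ^+ 2)^-1).
set N := A^T *m A in AE.
have sC i : toC (s i) != 0 by rewrite fmorph_eq0.
have Nunit : N \in unitmx by rewrite unitmx_mul unitmx_tr Aunit.
have ND' : map_mx toC (invmx N) = invmx P *m D' *m P.
  have NCunit : map_mx toC N \in unitmx by rewrite map_unitmx.
  have E : invmx P *m D' *m P *m map_mx toC N = 1%:M.
    rewrite AE !mulmxA -[_ *m P *m invmx P]mulmxA mulmxV // mulmx1.
    rewrite -[_ *m D' *m D]mulmxA mulmx_diag.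
    rewrite (_ : diag_mx _ = 1%:M) ?mulmx1 ?mulVmx //.
    by rewrite -diag_const_mx; congr diag_mx; apply/rowP => i;
       rewrite !mxE mulVf // expf_neq0.
  by rewrite map_invmx -[RHS](mulmxK NCunit) E mul1mx.
have GE : (A + Cof A)^T *m (A + Cof A) = N + 1%:M + (1%:M + invmx N).
  rewrite /Cof dA scale1r [(A + _)^T]linearD /= trmxK mulmxDl !mulmxDr mulVmx //.
  rewrite -trmx_mul mulVmx // trmx1; congr (_ + (_ + _)).
  rewrite -[LHS](mulmxK Nunit) /N trmx_inv !mulmxA mulmxKV ?unitmx_tr //.
  by rewrite mulVmx // mul1mx.
apply: (map_poly_inj toC); rewrite map_char_poly GE !map_mxD AE ND' map_mx1.
have -> : invmx P *m D *m P + 1%:M + (1%:M + invmx P *m D' *m P) =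
    invmx P *m (diag_mx (\row_i toC ((s i + (s i)^-1) ^+ 2))) *m P.
  have -> : diag_mx (\row_i toC ((s i + (s i)^-1) ^+ 2)) =
      D + 1%:M + (1%:M + D').
    rewrite -diag_const_mx /D /D' -!raddfD; congr diag_mx.
    apply/rowP => i; rewrite !mxE rmorphXn rmorphD fmorphV; field; exact: sC.
  by rewrite !mulmxDr !mulmxDl mulmx1 mulVmx.
rewrite char_poly_conj // char_poly_trig ?diag_mx_is_trig // rmorph_prod /=.
by apply: eq_bigr => i _; rewrite !mxE eqxx mulr1n rmorphB /= map_polyX map_polyC.
Qed.

End SingularValueSums.

(** * Determinant and cofactor matrix along rank-one lines *)

Lemma det_add1_rank1 (K : comNzRingType) (n : nat) (u : 'cV[K]_n) (v : 'rV[K]_n) :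
  \det (1%:M + u *m v) = 1 + (v *m u) 0 0.
Proof.
(* Two block triangular factorizations of one block matrix give [det (1 + u v) = det (1 + v u)], and
   [v u] is 1 by 1. *)
have <- : \det (block_mx 1%:M (- u) v 1%:M) = \det (1%:M + u *m v).
  have -> : block_mx 1%:M (- u) v 1%:M =
      block_mx 1%:M (- u) 0 1%:M *m block_mx (1%:M + u *m v) 0 v 1%:M.
    by rewrite mulmx_block !(mul1mx, mulmx0, mul0mx, mulmx1, add0r, mulNmx) addrK.
  by rewrite det_mulmx det_ublock det_lblock !det1 !mul1r mulr1.
have -> : block_mx 1%:M (- u) v 1%:M =
    block_mx 1%:M 0 v 1%:M *m block_mx 1%:M (- u) 0 (1%:M + v *m u).
  rewrite mulmx_block !(mul1mx, mulmx0, mul0mx, mulmx1, add0r, addr0, mulmxN).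
  by rewrite addrC addrK.
rewrite det_mulmx det_ublock det_lblock !det1 !mul1r.
by rewrite det_mx11 !mxE.
Qed.

Section RankOne.
Variables (R : realType) (n : nat).
Implicit Types (F : 'M[R]_n) (a b : 'cV[R]_n).

(* [det (F + a b^T) = 1] forces [b^T F^-1 a = 0], which kills the quadratic term
   of the cofactor matrix along the line. *)
Lemma Cof_rank1_affine F a b t : \det F = 1 -> \det (F + a *m b^T) = 1 ->
  Cof (F + t *: (a *m b^T)) =
  Cof F - t *: (invmx F *m a *m (b^T *m invmx F))^T.
Proof.
move=> dF dFab.
have Fu : F \in unitmx by rewrite unitmxE dF unitr1.
have FtE r : F + r *: (a *m b^T) = F *m (1%:M + r *: (invmx F *m a) *m b^T).
  by rewrite mulmxDr mulmx1 -scalemxAl -scalemxAr !mulmxA mulmxV // mul1mx.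
have dFt r : \det (F + r *: (a *m b^T)) = 1 + r * (b^T *m invmx F *m a) 0 0.
  by rewrite FtE det_mulmx dF mul1r det_add1_rank1 -scalemxAr mxE mulmxA.
have c0 : b^T *m invmx F *m a = 0.
  apply/matrixP => i j; rewrite !ord1 [RHS]mxE.
  have := dFt 1; rewrite scale1r dFab mul1r -{1}[1]addr0.
  by move=> /addrI.
have dt : \det (F + t *: (a *m b^T)) = 1 by rewrite dFt c0 mxE mulr0 addr0.
have Ftu : F + t *: (a *m b^T) \in unitmx by rewrite unitmxE dt unitr1.
rewrite /Cof dt dF !scale1r; set N := _ *m (b^T *m _).
transitivity (invmx F - t *: N)^T; last by rewrite linearB linearZ.
rewrite {}/N; congr (_^T).
(* Multiplying the claimed inverse by [F + t a b^T] must give the identity: with [u = F^-1 a], the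
   terms in [t] cancel and the one in [t^2] contains [b^T u = 0]. *)
rewrite -[RHS](mulmxK Ftu) -[LHS]mul1mx; congr (_ *m _).
have [u uE] : exists u, invmx F *m a = u by exists (invmx F *m a).
rewrite FtE uE [(_ - _) *m (F *m _)]mulmxA mulmxBl mulVmx // -!scalemxAl.
rewrite -[u *m _ *m F]mulmxA mulmxKV //.
have bu : b^T *m u = 0 by rewrite -uE mulmxA.
rewrite mulmxBl mul1mx mulmxDr mulmx1 -!scalemxAl -!scalemxAr mulmxA.
by rewrite -[u *m b^T *m u]mulmxA bu mulmx0 mul0mx !scaler0 addr0 addrK.
Qed.

End RankOne.

(** * Hyperbolic inequalities and supporting lines of [gbar] *)

Section Hyperbolic.
Variable R : realType.
Implicit Types x y t k : R.

Lemma is_derive_ge0_le (f df : R -> R) (a b : R) : a <= b ->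
    (forall x, a <= x <= b -> is_derive x 1 f (df x) /\ 0 <= df x) ->
  f a <= f b.
Proof.
move=> ab fd.
have [||c cab] := @MVT_segment _ f df _ _ ab.
- by move=> z /subset_itv_oo_cc; rewrite in_itv => /fd [].
- apply: derivable_within_continuous => z; rewrite in_itv.
  by move=> /fd [[]].
rewrite -subr_ge0 => ->; rewrite mulr_ge0 ?subr_ge0 //.
by move: cab; rewrite in_itv => /fd [].
Qed.

Definition sinh x : R := (expR x - expR (- x)) / 2.

#[local] Instance is_derive_cosh x : is_derive x 1 (@cosh R) (sinh x).
Proof.
rewrite /cosh /sinh; apply: is_derive_eq; rewrite /GRing.scale /=; by field.
Qed.

#[local] Instance is_derive_sinh x : is_derive x 1 sinh (cosh x).
Proof.
rewrite /cosh /sinh; apply: is_derive_eq; rewrite /GRing.scale /=; by field.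
Qed.

Lemma cosh0 : cosh 0 = 1 :> R.
Proof. by rewrite /cosh oppr0 expR0 divff. Qed.

Lemma sinh0 : sinh 0 = 0.
Proof. by rewrite /sinh oppr0 subrr mul0r. Qed.

Lemma sinh_gt0 x : 0 < x -> 0 < sinh x.
Proof. by move=> x0; rewrite divr_gt0 // subr_gt0 ltr_expR gtrN. Qed.

Lemma sinh_ge0 x : 0 <= x -> 0 <= sinh x.
Proof. by rewrite le_eqVlt => /predU1P[<-|/sinh_gt0/ltW //]; rewrite sinh0. Qed.

Lemma sinh_le_mul_cosh x : 0 <= x -> sinh x <= x * cosh x.
Proof.
move=> x0; rewrite -subr_ge0.
rewrite [leLHS](_ : _ = 0 * cosh 0 - sinh 0); last by rewrite sinh0 mul0r subrr.
apply: (@is_derive_ge0_le (fun x => x * cosh x - sinh x) (fun x => x * sinh x)) => //.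
move=> z /andP[z0 _]; split; last by rewrite mulr_ge0 // sinh_ge0.
by apply: is_derive_eq; rewrite /GRing.scale /=; ring.
Qed.

(** The difference vanishes at 0 and has derivative [x / 3 * (x cosh x - sinh x)]. With [1 / 3] the
    Taylor expansions agree up to order three; this is the source of the threshold [1 / 6]. *)
Lemma mul_cosh_le x : 0 <= x -> x * cosh x <= (1 + x ^+ 2 / 3) * sinh x.
Proof.
move=> x0; rewrite -subr_ge0.
rewrite [leLHS](_ : _ = (1 + 0 ^+ 2 / 3) * sinh 0 - 0 * cosh 0); last first.
  by rewrite sinh0 mulr0 mul0r subrr.
apply: (@is_derive_ge0_le (fun x => (1 + x ^+ 2 / 3) * sinh x - x * cosh x)
  (fun x => x / 3 * (x * cosh x - sinh x))) => //.
move=> z /andP[z0 _]; split.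
  by apply: is_derive_eq; rewrite /GRing.scale /=; field.
by rewrite mulr_ge0 ?divr_ge0 // subr_ge0 sinh_le_mul_cosh.
Qed.

(* At [x = 0] the quotient [x e^(k x^2) / sinh x] is extended by its limit [1]. *)
Definition slope k x : R := if x == 0 then 1 else x * expR (k * x ^+ 2) / sinh x.

Lemma slopeE k x : slope k x * sinh x = x * expR (k * x ^+ 2).
Proof.
rewrite /slope; have [->|x0] := eqVneq x 0; first by rewrite sinh0 mulr0 mul0r.
rewrite divfK //; case: (ltgtP x 0) x0 => // x0 _; last first.
  by rewrite lt0r_neq0 // sinh_gt0.
rewrite -oppr_eq0 lt0r_neq0 // (_ : - sinh x = sinh (- x)).
  by rewrite sinh_gt0 // oppr_gt0.
by rewrite /sinh opprK; field.
Qed.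

(** The derivative has the sign of [(1 + 2 k z^2) sinh z - z cosh z], and [2 k >= 1 / 3]. *)
Lemma slope_le_gt0 k x y : 6^-1 <= k -> 0 < x -> x <= y -> slope k x <= slope k y.
Proof.
move=> k6 x0 xy; have y0 := lt_le_trans x0 xy.
rewrite /slope !gt_eqF //.
apply: (@is_derive_ge0_le (fun z => z * expR (k * z ^+ 2) / sinh z)
  (fun z => expR (k * z ^+ 2) *
    ((1 + 2 * k * z ^+ 2) * sinh z - z * cosh z) / sinh z ^+ 2)) => //.
move=> z /andP[xz _]; have z0 := lt_le_trans x0 xz; have sz := sinh_gt0 z0.
split.
  have sz' := lt0r_neq0 sz.
  apply: is_derive_eq; rewrite /GRing.scale /=; by field.
rewrite divr_ge0 ?exprn_ge0 ?(ltW sz) // mulr_ge0 ?expR_ge0 // subr_ge0.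
apply: le_trans (mul_cosh_le (ltW z0)) _.
rewrite ler_pM2r // lerD2l; have := sqr_ge0 z; nra.
Qed.

(** No limit at 0 is taken: if the slope at [x] were below 1, then at a small enough [e <= x] the
    bound [slope k e >= 1 / cosh e > expR (- e)] would contradict monotonicity. *)
Lemma slope_ge1 k x : 6^-1 <= k -> 0 <= x -> 1 <= slope k x.
Proof.
move=> k6; rewrite le_eqVlt => /predU1P[<-|x0]; first by rewrite /slope eqxx.
have m0 : 0 < slope k x.
  by rewrite /slope gt_eqF // divr_gt0 ?sinh_gt0 // mulr_gt0 // expR_gt0.
rewrite leNgt; apply/negP => m1.
pose e := Num.min x (- ln (slope k x)).
have e0 : 0 < e by rewrite lt_min x0 oppr_gt0 -ln1 ltr_ln ?posrE.
have ex : e <= x by rewrite ge_min lexx.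
have em : expR e * slope k x <= 1.
  have : expR e <= expR (- ln (slope k x)) by rewrite ler_expR ge_min lexx orbT.
  by rewrite expRN lnK ?posrE // -(ler_pM2r m0) mulVf // lt0r_neq0.
have ce : cosh e < expR e.
  by rewrite /cosh ltr_pdivrMr // mulr_natr mulr2n ltrD2l ltr_expR gtrN.
have c0 : 0 < cosh e by rewrite /cosh divr_gt0 // addr_gt0 // expR_gt0.
have : 1 <= cosh e * slope k e.
  rewrite -(ler_pM2l (sinh_gt0 e0)) mulr1 mulrCA [sinh e * _]mulrC slopeE.
  apply: le_trans (sinh_le_mul_cosh (ltW e0)) _.
  rewrite mulrC ler_pM2l // ler_peMr ?(ltW e0) // -expR0 ler_expR.
  by rewrite mulr_ge0 ?exprn_ge0 //; lra.
have := slope_le_gt0 k6 e0 ex.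
nra.
Qed.

Lemma slope_le k x y : 6^-1 <= k -> 0 <= x -> x <= y -> slope k x <= slope k y.
Proof.
move=> k6; rewrite le_eqVlt => /predU1P[<- y0|]; last exact: slope_le_gt0.
by rewrite {1}/slope eqxx slope_ge1.
Qed.

(* In the variable [x] with [s = 2 cosh x], the difference of the two sides has
   derivative [2 sinh x (slope k x - slope k x0)]. *)
Lemma exp_sqr_support k x0 x : 6^-1 <= k -> 0 <= x0 -> 0 <= x ->
  k^-1 * expR (k * x0 ^+ 2) + slope k x0 * (2 * cosh x - 2 * cosh x0) <=
  k^-1 * expR (k * x ^+ 2).
Proof.
move=> k6 x0_ge0 x_ge0.
have kN0 : k != 0 by apply/lt0r_neq0; lra.
pose phi z := k^-1 * expR (k * z ^+ 2) - 2 * slope k x0 * cosh z.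
pose dphi z := 2 * (slope k z - slope k x0) * sinh z.
have dphiE (z : R) : is_derive z 1 phi (dphi z).
  rewrite /dphi mulrBr mulrBl -mulrA slopeE.
  by apply: is_derive_eq; rewrite /GRing.scale /=; field.
suff : phi x0 <= phi x by rewrite /phi; lra.
have [xx0|x0x] := leP x0 x.
  apply: (is_derive_ge0_le xx0) => z /andP[x0z _]; split=> //.
  have z0 := le_trans x0_ge0 x0z.
  by rewrite mulr_ge0 ?sinh_ge0 // mulr_ge0 // subr_ge0 slope_le.
rewrite -lerN2.
apply: (@is_derive_ge0_le (fun z => - phi z) (fun z => - dphi z)).
  exact: ltW.
move=> z /andP[xz zx0]; have z0 := le_trans x_ge0 xz; split.
  exact: is_deriveN.
by rewrite oppr_ge0 mulr_le0_ge0 ?sinh_ge0 // pmulr_rle0 // subr_le0 slope_le.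
Qed.

Lemma cosh_surj (s : R) : 1 <= s -> exists2 x, 0 <= x & cosh x = s.
Proof.
move=> s1; pose r := Num.sqrt (s ^+ 2 - 1).
have r2 : r ^+ 2 = s ^+ 2 - 1 by rewrite sqr_sqrtr //; nra.
have r0 : 0 <= r by exact: sqrtr_ge0.
have sr0 : 0 < s + r by lra.
(* The logarithmic formula for arcosh; it works because [(s + r) (s - r) = 1]. *)
exists (ln (s + r)); first by rewrite ln_ge0; lra.
rewrite /cosh expRN lnK ?posrE //.
suff -> : (s + r)^-1 = s - r by field.
apply: (mulfI (lt0r_neq0 sr0)); rewrite divff ?lt0r_neq0 //.
by rewrite mulrC -subr_sqr r2 opprB addrC subrK.
Qed.

Lemma gbar_cosh (mu k x : R) : 0 <= x ->
  gbar mu k (2 * cosh x) = mu / k * expR (k * x ^+ 2).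
Proof.
move=> x0; rewrite gbar_ge2.
  by rewrite [2 * _]mulrC mulfK // coshK // inE /= in_itv /= x0.
have c1 : 1 <= cosh x; last by lra.
rewrite -[leLHS]cosh0; apply: (@is_derive_ge0_le (@cosh R) sinh _ _ x0) => z /andP[z0 _].
by split; [exact: is_derive_cosh|exact: sinh_ge0].
Qed.

(** The slope is [mu] on the affine branch and [mu * slope k x0] at [s = 2 cosh x0]; they match at
    2, where [slope k 0 = 1]. Negative arguments are included because diagonal entries in singular
    bases can be negative. *)
Lemma gbar_support (mu k s : R) : 0 < mu -> 6^-1 <= k ->
  exists2 m, 0 <= m & forall y, gbar mu k s + m * (y - s) <= gbar mu k y.
Proof.
move=> mu0 k6.
have cosh2 y : 2 <= y -> exists2 x, 0 <= x & y = 2 * cosh x.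
  move=> y2; have [|x x0 xE] := @cosh_surj (y / 2); first by lra.
  by exists x => //; rewrite xE; field.
have le2 y : y <= 2 -> gbar mu k y = mu / k + mu * (y - 2).
  by rewrite /gbar => ->.
have supp x0 x : 0 <= x0 -> 0 <= x ->
    gbar mu k (2 * cosh x0) + mu * slope k x0 * (2 * cosh x - 2 * cosh x0) <=
    gbar mu k (2 * cosh x).
  move=> x0_ge0 x_ge0; rewrite !gbar_cosh // -!mulrA -mulrDr ler_pM2l //.
  exact: exp_sqr_support.
have gbar2 : gbar mu k (2 * cosh 0) = mu / k.
  by rewrite cosh0 mulr1 le2 // subrr mulr0 addr0.
have [s2|/ltW s2] := leP s 2.
  exists mu; first exact: ltW.
  move=> y; rewrite le2 //; have [y2|/ltW y2] := leP y 2.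
    by rewrite le2 //; lra.
  have [x x0 ->] := cosh2 _ y2; have := supp 0 x (lexx 0) x0.
  by rewrite gbar2 /slope eqxx cosh0; lra.
have [x0 x0_ge0 ->] := cosh2 _ s2.
have m1 := slope_ge1 k6 x0_ge0.
exists (mu * slope k x0); first by rewrite mulr_ge0 ?ltW //; lra.
move=> y; have [y2|/ltW y2] := leP y 2; last first.
  by have [x x_ge0 ->] := cosh2 _ y2; exact: supp.
rewrite [leRHS]le2 //.
(* The line lies below [gbar] at 2, and its slope is at least [mu], so to the left of 2 it stays
   below the affine branch. *)
have := supp x0 0 x0_ge0 (lexx 0); rewrite gbar2 cosh0.
have : mu * (y - 2) * (slope k x0 - 1) <= 0.
  by rewrite mulr_le0_ge0 ?(pmulr_rle0 _ mu0) ?subr_le0 ?subr_ge0.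
lra.
Qed.

End Hyperbolic.

(** * Convexity of [P_exp], restriction to SL(3), rank-one convexity *)

Theorem proposition3p1 (R : realType) (mu k : R) (mu_gt0 : 0 < mu)
    (k_ge : 6^-1 <= k) :
  [/\ convex_function (@poly_dom R) (P_exp mu k),
      polyconvex (fun F => P_exp mu k (F, Cof F, \det F)),
      (forall F : 'M[R]_3, SL3 F ->
         W_exp mu k F = P_exp mu k (F, Cof F, \det F))
    & rank_one_convex_SL3 (W_exp mu k)].
Proof.
have gconv (A B : 'M[R]_3) (l : R) : 0 <= l <= 1 ->
    \sum_i gbar mu k (nu (l *: A + (1 - l) *: B) i) <=
    l * \sum_i gbar mu k (nu A i) + (1 - l) * \sum_i gbar mu k (nu B i).
  by move=> l01; apply: sum_nu_convex => // s; exact: gbar_support.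
have Pconvex : convex_function (@poly_dom R) (P_exp mu k).
  move=> t [[A B] c] [[A' B'] c'] _ _.
  have t01 : 0 <= t%:num <= 1 by rewrite ge0 le1.
  have convE : t%:num *: (A + B) + (1 - t%:num) *: (A' + B') =
      t%:num *: A + (1 - t%:num) *: A' + (t%:num *: B + (1 - t%:num) *: B').
    by rewrite !scalerDr addrACA.
  have := gconv (A + B) (A' + B') _ t01.
  by rewrite convE.
have WP (F : 'M[R]_3) : SL3 F -> W_exp mu k F = P_exp mu k (F, Cof F, \det F).
  move=> dF; have [s [s0 nuF nuG]] := sum_nu_add_Cof (gbar mu k) dF.
  rewrite /W_exp /P_exp /= nuG (nuF (fun x => expR (k * ln x ^+ 2))) mulr_sumr.
  apply: eq_bigr => i _.
  (* The absolute value makes the argument of [cosh] nonnegative, as [gbar_cosh] requires; the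
     square in the energy absorbs it. *)
  have -> : s i + (s i)^-1 = 2 * cosh `|ln (s i)|.
    rewrite /cosh; case: ger0P => _; rewrite ?opprK expRN lnK ?posrE //; field.
      by rewrite lt0r_neq0.
    by rewrite lt0r_neq0.
  by rewrite gbar_cosh // real_normK ?num_real.
split=> //; first by exists (P_exp mu k).
move=> F a b dF dFt t x y x01 y01.
rewrite !inE /= !in_itv /= in x01 y01.
have t01 : 0 <= t%:num <= 1 by rewrite ge0 le1.
have txy01 : 0 <= t%:num * x + (1 - t%:num) * y <= 1 by nra.
have dF1 : \det (F + a *m b^T) = 1.
  by have := dFt 1; rewrite scale1r; apply; rewrite ler01 lexx.
pose G r := F + r *: (a *m b^T) + Cof (F + r *: (a *m b^T)).
(* Both [F] and its cofactor matrix are affine in the parameter, so [gconv] applied to [G x] and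
   [G y] gives the inequality. *)
have convE : G (t%:num * x + (1 - t%:num) * y) =
    t%:num *: G x + (1 - t%:num) *: G y.
  rewrite /G !(Cof_rank1_affine _ dF dF1).
  by apply/matrixP => p q; rewrite !mxE; ring.
have WG r : 0 <= r <= 1 ->
    W_exp mu k (F + r *: (a *m b^T)) = \sum_i gbar mu k (nu (G r) i).
  by move=> /dFt/WP.
have conv_eq (u v w u' v' w' : R) : u = u' -> v = v' -> w = w' ->
    u' <= t%:num * v' + (1 - t%:num) * w' ->
    u <= t%:num * v + (1 - t%:num) * w by move=> -> -> ->.
have := gconv (G x) (G y) _ t01; rewrite -convE.
exact: conv_eq (WG _ txy01) (WG _ x01) (WG _ y01).
Qed.
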